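(* Let $H=(V,E)$ be a connected finite hypergraph with vertex measure $\mu$ and hyperedge weight $\omega$. Let $\Omega$ be a non-empty finite subset of $V$ such that $\Omega^c=V\setminus\Omega$ is non-empty, and let $\phi:V\to\mathbb{R}$ be any function. If $\Delta\phi(v)\ge0$ for all $v\in\Omega$, then $$\max_{\Omega}\phi\le\max_{\Omega^c}\phi.$$ If $\Delta\phi(v)\le0$ for all $v\in\Omega$, then $$\min_{\Omega}\phi\ge\min_{\Omega^c}\phi.$$
   Context: A (finite, undirected) hypergraph $H=(V,E)$ consists of a finite vertex set $V$ and a set $E$ of hyperedges, each hyperedge $e\in E$ being a subset of $V$ with cardinality $\delta_e:=|e|$ satisfying $2\le\delta_e\le|V|$. $H$ is connected if for any two different vertices $v,v'$ there is a sequence of hyperedges $e_1,\dots,e_l\in E$ with $v\in e_1$, $v'\in e_l$ and $e_n\cap e_{n+1}\ne\emptyset$ for $1\le n\le l-1$. The measure is a function $\mu:V\to(0,\infty)$ and the weight is a function $\omega:E\to(0,\infty)$, written $\omega_e=\omega(e)$. The Laplace operator (divergence of the hypergraph gradient) of $\phi:V\to\mathbb{R}$ is given explicitly by $$\Delta\phi(v)=\frac{1}{\mu(v)}\sum_{e\in E:\,v\in e}\frac{\omega_e}{\delta_e-1}\sum_{u\in e:\,u\ne v}(\phi(u)-\phi(v)),\quad v\in V.$$ *)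

(* Defs.v *)
From HB Require Import structures.
From mathcomp Require Import all_boot all_order all_algebra.
From mathcomp Require Import reals.

Set Implicit Arguments.
Unset Strict Implicit.
Unset Printing Implicit Defensive.

Import Order.TTheory GRing.Theory Num.Theory.
Local Open Scope ring_scope.

Record hypergraph (V : finType) := Hypergraph {
  edges : {set {set V}};
  edges_card : forall e : {set V}, e \in edges -> (2 <= #|e| <= #|V|)%N
}.

(* The chain e_1, ..., e_l is the nonempty sequence e :: s. *)
Definition connected_hypergraph (V : finType) (H : hypergraph V) : Prop :=
  forall v v' : V, v != v' ->
  exists (e : {set V}) (s : seq {set V}),
    [/\ {subset e :: s <= edges H}, v \in e, v' \in last e s
      & path (fun f g : {set V} => f :&: g != set0) e s].

Definition is_measure (R : realType) (V : finType) (mu : V -> R) : Prop :=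
  forall v : V, 0 < mu v.

(* A weight is a total function on subsets of V; its values outside the edge
   set are unconstrained and never used. *)
Definition is_weight (R : realType) (V : finType) (H : hypergraph V)
    (w : {set V} -> R) : Prop :=
  forall e : {set V}, e \in edges H -> 0 < w e.

Definition laplacian (R : realType) (V : finType) (H : hypergraph V)
    (mu : V -> R) (w : {set V} -> R) (phi : V -> R) (v : V) : R :=
  (mu v)^-1 *
  \sum_(e in edges H | v \in e)
    w e / (#|e|%:R - 1) * \sum_(u in e | u != v) (phi u - phi v).

(* Maximum and minimum of phi over A; the value 0 on the empty set is junk. *)
Definition max_on (R : realType) (V : finType) (A : {set V}) (phi : V -> R) : R :=
  if [pick x in A] is Some x0 then phi [arg max_(x > x0 in A) phi x]%O else 0.

Definition min_on (R : realType) (V : finType) (A : {set V}) (phi : V -> R) : R :=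
  if [pick x in A] is Some x0 then phi [arg min_(x < x0 in A) phi x]%O else 0.

(* Main.v *)
Require Import Defs.
From HB Require Import structures.
From mathcomp Require Import all_boot all_order all_algebra.
From mathcomp Require Import reals.
Set Implicit Arguments.
Unset Strict Implicit.
Unset Printing Implicit Defensive.
Import Order.TTheory GRing.Theory Num.Theory.
Local Open Scope ring_scope.

(** The maximum principle holds because, at a point [v] where [phi] attains its
    maximum over [V], the Laplacian is a positive combination of the
    nonpositive differences [phi u - phi v]. If it is also nonnegative, all
    these differences vanish, so [phi] is constant on every hyperedge through
    [v] ([laplacian_ge0_max_constant]).

    Suppose no point outside [Omega] attained the global maximum. The set where
    it is attained would then lie in [Omega], hence contain every hyperedge
    that it meets, and by connectedness it would be all of [V]
    ([edge_saturated_full]), contradicting that the complement of [Omega] is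
    non-empty. So the global maximum is attained outside [Omega]
    ([global_max_outside]), which bounds the maximum over [Omega]. The minimum
    principle is the same statement for [- phi]. *)

Section Hypergraph.

Variables (R : realType) (V : finType) (H : hypergraph V).

(** Consecutive hyperedges of a chain intersect, so membership in [S] spreads
    from the first hyperedge of a chain to the last. *)
Lemma edge_saturated_full (S : {set V}) :
  connected_hypergraph H ->
  (forall e v, e \in edges H -> v \in e -> v \in S -> e \subset S) ->
  S != set0 -> S = [set: V].
Proof.
move=> conn sat /set0Pn[v vS]; apply/setP => u; rewrite inE.
have [<-//|vu] := eqVneq v u.
have [e [s [es_edges ve + es_path]]] := conn v u vu.
have: e \subset S by apply: (sat e v) => //; apply: es_edges; rewrite mem_head.
elim: s e es_edges es_path {ve} => [|f s IH] e es_edges /=.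
  by move=> _ /subsetP eS /eS.
case/andP=> /set0Pn[x /setIP[xe xf]] fs_path /subsetP eS.
have fs_edges : {subset f :: s <= edges H}.
  by move=> g gfs; apply: es_edges; rewrite inE gfs orbT.
apply: IH => //; apply: (sat f x) => //; last exact: eS.
by apply: fs_edges; rewrite mem_head.
Qed.

Variables (mu : V -> R) (w : {set V} -> R).

Lemma laplacianN (phi : V -> R) (v : V) :
  laplacian H mu w (fun x => - phi x) v = - laplacian H mu w phi v.
Proof.
rewrite /laplacian -mulrN -sumrN; congr (_ * _); apply: eq_bigr => e _.
by rewrite -mulrN -sumrN; congr (_ * _); apply: eq_bigr => u _; rewrite opprD.
Qed.

Hypotheses (mu_pos : is_measure mu) (w_pos : is_weight H w).

(** A sum of nonpositive terms with a nonnegative total has only zero terms;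
    this applies first to the sum over hyperedges, then to the sum over the
    vertices of one hyperedge. *)
Lemma laplacian_ge0_max_constant (phi : V -> R) (v : V) :
  (forall u, phi u <= phi v) -> 0 <= laplacian H mu w phi v ->
  forall e u, e \in edges H -> v \in e -> u \in e -> phi u = phi v.
Proof.
move=> vmax + e u eH ve ue; have [->//|uv] := eqVneq u v.
have coef_gt0 f : f \in edges H -> 0 < w f / (#|f|%:R - 1).
  move=> fH; have /andP[f_ge2 _] := edges_card fH.
  by rewrite divr_gt0 ?w_pos // subr_gt0 ltr1n.
have diff_ge0 x : 0 <= phi v - phi x by rewrite subr_ge0.
have inner_ge0 (f : {set V}) : 0 <= \sum_(x in f | x != v) (phi v - phi x).
  by apply: sumr_ge0 => x _.
rewrite -oppr_le0 -laplacianN /laplacian pmulr_rle0 ?invr_gt0 //.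
under eq_bigr do under eq_bigr do rewrite opprK addrC.
set s := (X in X <= 0) => s_le0.
have term_ge0 f : (f \in edges H) && (v \in f) ->
    0 <= w f / (#|f|%:R - 1) * \sum_(x in f | x != v) (phi v - phi x).
  by case/andP=> fH _; rewrite mulr_ge0 // ltW ?coef_gt0.
have s_eq0 : s = 0 by apply/le_anti; rewrite s_le0 sumr_ge0.
have eP : (e \in edges H) && (v \in e) by rewrite eH.
have /eqP := psumr_eq0P term_ge0 s_eq0 eP.
rewrite mulf_eq0 gt_eqF ?coef_gt0 //= => /eqP inner_eq0.
have uP : (u \in e) && (u != v) by rewrite ue.
have /eqP := psumr_eq0P (fun x _ => diff_ge0 x) inner_eq0 uP.
by rewrite subr_eq0 => /eqP.
Qed.

Lemma global_max_outside (Omega : {set V}) (phi : V -> R) :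
  connected_hypergraph H -> ~: Omega != set0 ->
  (forall v, v \in Omega -> 0 <= laplacian H mu w phi v) ->
  exists2 u, u \in ~: Omega & forall x, phi x <= phi u.
Proof.
move=> conn /set0Pn[z zO] lap_ge0.
pose m := [arg max_(x > z) phi x]%O.
have m_max x : phi x <= phi m by rewrite /m; case: arg_maxP => // i _; apply.
pose S := [set x | phi x == phi m].
have [SO|] := boolP (S \subset Omega); last first.
  case/subsetPn=> u; rewrite inE => /eqP um uO.
  by exists u; [rewrite inE | move=> x; rewrite um].
have S_full : S = [set: V].
  apply: edge_saturated_full => // [e v eH ve vS|]; last first.
    by apply/set0Pn; exists m; rewrite inE.
  have /eqP vm : phi v == phi m by rewrite inE in vS.
  apply/subsetP => u ue; rewrite inE -vm.
  apply/eqP/(laplacian_ge0_max_constant _ _ eH ve ue).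
    by move=> x; rewrite vm.
  exact/lap_ge0/(subsetP SO).
by move: zO; rewrite inE (subsetP SO) // S_full.
Qed.

End Hypergraph.

Section Extrema.

Variables (R : realType) (V : finType) (A : {set V}) (phi : V -> R).

Lemma max_on_attained : A != set0 -> exists2 x, x \in A & max_on A phi = phi x.
Proof.
case/set0Pn=> y yA; rewrite /max_on; case: pickP => [x0 x0A|/(_ y)]; last first.
  by rewrite yA.
by case: arg_maxP => // x xA _; exists x.
Qed.

Lemma max_on_ge (y : V) : y \in A -> phi y <= max_on A phi.
Proof.
move=> yA; rewrite /max_on; case: pickP => [x0 x0A|/(_ y)]; last by rewrite yA.
by case: arg_maxP => // x _; apply.
Qed.

Lemma min_on_attained : A != set0 -> exists2 x, x \in A & min_on A phi = phi x.
Proof.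
case/set0Pn=> y yA; rewrite /min_on; case: pickP => [x0 x0A|/(_ y)]; last first.
  by rewrite yA.
by case: arg_minP => // x xA _; exists x.
Qed.

Lemma min_on_le (y : V) : y \in A -> min_on A phi <= phi y.
Proof.
move=> yA; rewrite /min_on; case: pickP => [x0 x0A|/(_ y)]; last by rewrite yA.
by case: arg_minP => // x _; apply.
Qed.

End Extrema.

Theorem lemma3p5 (R : realType) (V : finType) (H : hypergraph V)
    (mu : V -> R) (w : {set V} -> R) (Omega : {set V}) (phi : V -> R)
    (H_conn : connected_hypergraph H)
    (mu_pos : is_measure mu) (w_pos : is_weight H w)
    (Omega_neq0 : Omega != set0) (OmegaC_neq0 : ~: Omega != set0) :
  ((forall v : V, v \in Omega -> 0 <= laplacian H mu w phi v) ->
     max_on Omega phi <= max_on (~: Omega) phi) /\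
  ((forall v : V, v \in Omega -> laplacian H mu w phi v <= 0) ->
     min_on (~: Omega) phi <= min_on Omega phi).
Proof.
split=> lap.
  have [u uO u_max] := global_max_outside mu_pos w_pos H_conn OmegaC_neq0 lap.
  have [x _ ->] := max_on_attained phi Omega_neq0.
  exact: le_trans (u_max x) (max_on_ge phi uO).
have lapN v : v \in Omega -> 0 <= laplacian H mu w (fun x => - phi x) v.
  by move=> vO; rewrite laplacianN oppr_ge0 lap.
have [u uO u_min] := global_max_outside mu_pos w_pos H_conn OmegaC_neq0 lapN.
have [x _ ->] := min_on_attained phi Omega_neq0.
by apply: le_trans (min_on_le phi uO) _; rewrite -lerN2 u_min.
Qed.
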